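(* Let $d\geq 2$, let $C=Z(\mathbb{R}_+^d)$ for some linear automorphism $Z$ of $\mathbb{R}^d$, and assume that $C$ is a Weyl chamber of a finite Coxeter group $H$. Let $\mathcal{S}\subset\mathbb{R}^d$ be a finite set with weights $a(s)\geq 0$ ($s\in\mathcal{S}$) satisfying $\sum_{s\in\mathcal{S}}a(s)=1$, $\sum_{s\in\mathcal{S}}a(s)s=0$ and $\sum_{s\in\mathcal{S}}a(s)s_is_j=\delta_{i,j}$ for all $i,j\in\{1,\dots,d\}$. Assume that $\mathcal{S}$ and the associated weights are invariant under the action of $H$, i.e., $h\mathcal{S}=\mathcal{S}$ and $a(hs)=a(s)$ for all $h\in H$ and $s\in\mathcal{S}$. Then the polynomial $P_0$ associated with $H$ is discrete harmonic, i.e., $L_{\mathcal{S}}(P_0)=0$.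
   Context: Here $\mathbb{R}_+=[0,\infty)$, $s=(s_1,\dots,s_d)$ are the coordinates of $s$ in the canonical basis, and $\delta_{i,j}$ is the Kronecker symbol. The discrete Laplacian is $L_{\mathcal{S}}(f)(x)=\sum_{s\in\mathcal{S}}a(s)f(x+s)-f(x)$ for $f:\mathbb{R}^d\to\mathbb{R}$. A finite Coxeter group here means a finite subgroup of $O(d)$ generated by (orthogonal) reflections through linear hyperplanes; its Weyl chambers are the closures of the connected components of the complement in $\mathbb{R}^d$ of the union of all hyperplanes $F$ such that the reflection $r_F$ through $F$ belongs to the group. When $C$ is a Weyl chamber of $H$, the group $H$ is generated by the reflections through the $d$ walls of $C$. Let $\Lambda=\{F_1,\dots,F_r\}$ be the set of all linear hyperplanes $F$ of $\mathbb{R}^d$ such that $r_F\in H$. For each $i$ choose a linear form $f_i$ with $F_i=\ker f_i$, and set $P_0=\prod_{i=1}^r f_i$, the choice being made so that $P_0>0$ on the interior of $C$ ($P_0$ is determined up to a positive multiplicative constant). *)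

(* Defs.v *)
From HB Require Import structures.
From mathcomp Require Import all_boot all_order all_algebra finmap.
From mathcomp Require Import all_classical all_reals all_analysis.

Set Implicit Arguments.
Unset Strict Implicit.
Unset Printing Implicit Defensive.

Import Order.TTheory GRing.Theory Num.Theory.
Import numFieldNormedType.Exports.

Local Open Scope classical_set_scope.
Local Open Scope ring_scope.

(* Vectors of R^d are column vectors 'cV[R]_d, and an element of O(d) is
   identified with its matrix in the canonical basis. *)

Section Coxeter.
Context {R : realType} {d : nat}.

Definition dot (x y : 'cV[R]_d) : R := \sum_(i < d) x i 0 * y i 0.

Definition ker_form (f : {scalar 'cV[R]_d}) : set 'cV[R]_d :=
  [set x | f x = 0].

Definition linear_hyperplane (F : set 'cV[R]_d) : Prop :=
  exists f : {scalar 'cV[R]_d}, (exists x, f x != 0) /\ F = ker_form f.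

(* M is r_F: the identity on F and minus the identity on the orthogonal of F *)
Definition is_reflection_through (F : set 'cV[R]_d) (M : 'M[R]_d) : Prop :=
  (forall x, F x -> M *m x = x) /\
  (forall y, (forall x, F x -> dot x y = 0) -> M *m y = - y).

Definition reflections : set 'M[R]_d :=
  [set M | exists F, linear_hyperplane F /\ is_reflection_through F M].

Definition subgroup_of_Od (G : set 'M[R]_d) : Prop :=
  [/\ G `<=` [set M | M^T *m M = 1%:M],
      G 1%:M,
      (forall M N, G M -> G N -> G (M *m N)) &
      (forall M, G M -> G (invmx M))].

Definition finite_coxeter_group (H : set 'M[R]_d) : Prop :=
  [/\ subgroup_of_Od H, finite_set H &
      exists2 X, X `<=` reflections & H = smallest subgroup_of_Od X].

Definition reflecting_hyperplanes (H : set 'M[R]_d) : set (set 'cV[R]_d) :=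
  [set F | linear_hyperplane F /\
           exists M, H M /\ is_reflection_through F M].

Definition regular_points (H : set 'M[R]_d) : set 'cV[R]_d :=
  ~` (\bigcup_(F in reflecting_hyperplanes H) F).

Definition weyl_chamber (H : set 'M[R]_d) (C : set 'cV[R]_d) : Prop :=
  exists2 x, regular_points H x &
    C = closure (connected_component (regular_points H) x).

Definition orthant : set 'cV[R]_d := [set x | forall i, 0 <= x i 0].

(* f enumerates, without repetition up to scaling, linear forms whose kernels
   are the reflecting hyperplanes of H. *)
Definition reflecting_forms (H : set 'M[R]_d) (r : nat)
    (f : 'I_r -> {scalar 'cV[R]_d}) : Prop :=
  set_bij [set: 'I_r] (reflecting_hyperplanes H) (fun i => ker_form (f i)).

Definition prod_forms (r : nat) (f : 'I_r -> {scalar 'cV[R]_d})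
    (x : 'cV[R]_d) : R := \prod_(i < r) f i x.

Definition laplacian (S : {fset 'cV[R]_d}) (a : 'cV[R]_d -> R)
    (g : 'cV[R]_d -> R) (x : 'cV[R]_d) : R :=
  (\sum_(s <- S) a s * g (x + s)) - g x.

End Coxeter.

(* Main.v *)
(* A reflection of [H] permutes the reflecting hyperplanes, so [P_0] changes sign
   under it, and by invariance of the weights so does [g = L_S(P_0)]; hence [g]
   vanishes on all [r] hyperplanes.  Since the weights sum to 1, the terms of
   degree [r] cancel in [g], so [g] has degree less than [r].  A generic line
   meets the hyperplanes in [r] distinct points, so [g] vanishes on it.
   Polynomials in [d] variables are handled by restriction to lines. *)
Require Import Defs.
From HB Require Import structures.
From mathcomp Require Import all_boot all_order all_algebra finmap.
From mathcomp Require Import all_classical all_reals all_analysis.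
From mathcomp Require Import ring.

Set Implicit Arguments.
Unset Strict Implicit.
Unset Printing Implicit Defensive.

Import Order.TTheory GRing.Theory Num.Theory.
Import numFieldNormedType.Exports.

Local Open Scope classical_set_scope.
Local Open Scope ring_scope.


(** * Polynomial identities and generic points *)

Lemma horner_eq0 (R : numDomainType) (p : {poly R}) :
  (forall t, p.[t] = 0) -> p = 0.
Proof.
move=> p0; apply/eqP; apply: contraT => pN0.
(* The integers below [size p] would be distinct roots, one more than the degree allows. *)
have := @max_poly_roots _ p [seq i%:R | i <- iota 0 (size p)] pN0.
rewrite size_map size_iota ltnn; apply.
  by apply/allP => t _; rewrite /root p0.
by rewrite map_inj_uniq ?iota_uniq // => i j /eqP; rewrite eqr_nat => /eqP.
Qed.

Lemma horner_eq0_off_roots (R : numDomainType) (p q : {poly R}) :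
  q != 0 -> (forall t, q.[t] != 0 -> p.[t] = 0) -> p = 0.
Proof.
move=> qN0 pq; have /eqP : p * q = 0.
  apply: horner_eq0 => t; rewrite hornerM; have [->|/pq ->] := eqVneq q.[t] 0.
    by rewrite mulr0.
  by rewrite mul0r.
by rewrite mulf_eq0 (negbTE qN0) orbF => /eqP.
Qed.

Lemma nonroot (R : numDomainType) (p : {poly R}) :
  p != 0 -> exists t, p.[t] != 0.
Proof.
move=> pN0; apply: contrapT => noroot; case/eqP: pN0.
by apply: horner_eq0 => t; apply/eqP/negPn/negP => pt; apply: noroot; exists t.
Qed.

(* All coefficients from degree [n] on depend only on the slopes [b]. *)
Lemma coef_prod_affine (R : comNzRingType) n (a b : 'I_n -> R) j : (n <= j)%N ->
  (\prod_(i < n) ((a i)%:P + b i *: 'X))`_j = \prod_(i < n) b i *+ (j == n).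
Proof.
elim: n a b j => [|n IHn] a b j le_nj.
  by rewrite !big_ord0 coef1 mulrb; case: eqP.
case: j le_nj => // j; rewrite ltnS => le_nj.
rewrite !big_ord_recr /= mulrDr coefD coefMC -scalerAr coefZ coefMX /=.
rewrite !IHn // ?(leq_trans le_nj) // eqSS [j.+1 == n]gtn_eqF ?ltnS //.
by rewrite mulr0n mul0r add0r mulrnAr mulrC.
Qed.

(** Over an infinite field finitely many proper subspaces do not cover [V]. This supplies every
    generic point and direction below. *)
Lemma common_nonzero (R : numFieldType) (V : lmodType R) (I : finType)
    (P : pred I) (h : I -> V -> R) :
  (forall i, P i -> scalar (h i)) ->
  (forall i, P i -> exists u, h i u != 0) ->
  exists w, forall i, P i -> h i w != 0.
Proof.
move=> h_lin hN0.
suff [w hw] : exists w, forall i, i \in enum P -> h i w != 0.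
  by exists w => i Pi; apply: hw; rewrite mem_enum.
have: {subset enum P <= P} by move=> i; rewrite mem_enum.
elim: (enum P) => [_|i s IHs sP]; first by exists 0.
have [|w hw] := IHs; first by move=> j js; apply: sP; rewrite inE js orbT.
have [u hu] := hN0 i (sP _ (mem_head _ _)).
pose q j := (h j w)%:P + h j u *: 'X.
have qE j t : P j -> (q j).[t] = h j (t *: u + w).
  by move=> Pj; rewrite !hornerE h_lin // addrC mulrC.
have [t] : exists t, (\prod_(j <- i :: s) q j).[t] != 0.
  apply: nonroot; rewrite prodf_seq_neq0; apply/allP => j /=.
  (* Along the line [t *: u + w], the new form has nonzero slope and each earlier one a nonzero
     constant term. *)
  rewrite inE => /predU1P[->|js]; apply/eqP => /polyP.
    move=> /(_ 1); rewrite coefD coefC coefZ coefX /= mulr1 add0r coef0 => /eqP.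
    exact/negP.
  move=> /(_ 0); rewrite coefD coefC coefZ coefX /= mulr0 addr0 coef0 => /eqP.
  exact/negP/hw.
rewrite horner_prod prodf_seq_neq0 => /allP qt.
exists (t *: u + w) => j js; rewrite -qE; first exact: (qt j).
exact: sP.
Qed.

(** * Linear forms, normals and reflections *)

Section LinearForms.
Context {R : realType} {d : nat}.
Implicit Types (f g : {scalar 'cV[R]_d}) (x y : 'cV[R]_d) (M N : 'M[R]_d).

(** Subtracting a multiple of [u] moves [x] into the kernel of [f], where [g] vanishes too. *)
Lemma form_proportional f g u : f u != 0 ->
  (forall x, f x = 0 -> g x = 0) -> forall x, g x = g u / f u * f x.
Proof.
move=> fu fg x; have /fg : f (x - (f x / f u) *: u) = 0.
  by rewrite linearB linearZ /= divfK // subrr.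
by rewrite linearB linearZ /= => /subr0_eq ->; rewrite [LHS]mulrC -[RHS]mulrA [_^-1 * _]mulrC.
Qed.

Lemma ker_form_eq f g : (exists u, f u != 0) -> (exists u, g u != 0) ->
  (forall x, f x = 0 -> g x = 0) -> ker_form f = ker_form g.
Proof.
move=> [u fu] [v gv] fg; have gE := form_proportional fu fg.
apply/seteqP; split=> x; rewrite /ker_form /=; first exact: fg.
rewrite gE => /eqP; rewrite mulf_eq0 => /orP[/eqP c0|/eqP //].
by move: gv; rewrite gE c0 mul0r eqxx.
Qed.

Lemma linear_hyperplane_form f :
  linear_hyperplane (ker_form f) <-> exists u, f u != 0.
Proof.
split=> [[g [[u gu] fg]]|fN0]; last by exists f.
exists u; apply: contra gu => /eqP fu.
by have : ker_form f u by []; rewrite fg => /= ->.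
Qed.

(** The vector representing [f] through [dot], hence orthogonal to its kernel. *)
Definition normal f : 'cV[R]_d := \col_i f (delta_mx i 0).

Lemma dot_normal f x : dot (normal f) x = f x.
Proof.
rewrite [in RHS](matrix_sum_delta x) linear_sum; apply: eq_bigr => i _.
by rewrite big_ord1 linearZ /= mxE mulrC.
Qed.

Lemma dotC x y : dot x y = dot y x.
Proof. by apply: eq_bigr => i _; rewrite mulrC. Qed.

Lemma dotE x y : dot x y = (x^T *m y) 0 0.
Proof. by rewrite mxE; apply: eq_bigr => i _; rewrite mxE. Qed.

Lemma dot_mulmx M x y : dot x (M *m y) = dot (M^T *m x) y.
Proof. by rewrite !dotE trmx_mul trmxK mulmxA. Qed.

(** This value is the squared norm of [normal f]. *)
Lemma form_normal_neq0 f : (exists u, f u != 0) -> f (normal f) != 0.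
Proof.
move=> [u fu]; rewrite -dot_normal; apply: contra fu => /eqP /psumr_eq0P n0.
rewrite -dot_normal /dot big1 // => i _.
have /eqP := n0 (fun i _ => sqr_ge0 _) i isT.
by rewrite mulf_eq0 orbb => /eqP ->; rewrite mul0r.
Qed.

Lemma reflection_normal f M :
  is_reflection_through (ker_form f) M -> M *m normal f = - normal f.
Proof. by case=> _; apply=> x fx; rewrite dotC dot_normal. Qed.

Lemma reflection_conj F M N : M^T *m M = 1%:M ->
  is_reflection_through F N ->
  is_reflection_through [set x | F (M *m x)] (M^T *m (N *m M)).
Proof.
move=> MM [Nfix Nopp]; have MM' := mulmx1C MM; split=> [x Fx|y yF].
  by rewrite -!mulmxA Nfix // mulmxA MM mul1mx.
rewrite -!mulmxA Nopp ?mulmxN ?mulmxA ?MM ?mul1mx // => z Fz.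
by rewrite dot_mulmx; apply: yF; rewrite /= mulmxA MM' mul1mx.
Qed.

End LinearForms.

(** * The arrangement of reflecting hyperplanes and the product of its forms *)

Section Arrangement.
Context {R : realType} {d : nat} {H : set 'M[R]_d} {r : nat}.
Context {f : 'I_r -> {scalar 'cV[R]_d}}.
Hypotheses (HO : subgroup_of_Od H) (f_forms : reflecting_forms H f).
Implicit Types (x v s : 'cV[R]_d) (M : 'M[R]_d).

Lemma reflecting_form i : linear_hyperplane (ker_form (f i)) /\
  exists M, H M /\ is_reflection_through (ker_form (f i)) M.
Proof. by have [ff _ _] := f_forms; exact: ff. Qed.

Lemma reflecting_form_neq0 i : exists u, f i u != 0.
Proof. by apply/linear_hyperplane_form; have [] := reflecting_form i. Qed.

Lemma reflecting_forms_inj i j : (forall x, f i x = 0 -> f j x = 0) -> i = j.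
Proof.
move=> fij; have [_ finj _] := f_forms; apply: finj; rewrite ?inE //.
by apply: ker_form_eq fij; exact: reflecting_form_neq0.
Qed.

Lemma orthogonal_trmxK M : H M -> M^T *m M = 1%:M.
Proof. by case: HO => HO_orth _ _ _ HM; exact: HO_orth. Qed.

Lemma group_trmx M : H M -> H M^T.
Proof.
move=> HM; case: HO => _ _ _ /(_ _ HM) HV; have MM := orthogonal_trmxK HM.
suff -> : M^T = invmx M by [].
have [_ Mu] := mulmx1_unit MM.
by rewrite -[LHS]mulmx1 -(mulmxV Mu) mulmxA MM mul1mx.
Qed.

(** The kernel of [f i] pulled back by [M] is again a reflecting hyperplane, by conjugating its
    reflection; forms with the same kernel are proportional. *)
Lemma group_permutes_forms M : H M -> exists (s : 'I_r -> 'I_r) (c : 'I_r -> R),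
  injective s /\ forall i x, f i (M *m x) = c i * f (s i) x.
Proof.
move=> HM; have MM := orthogonal_trmxK HM; have MM' := mulmx1C MM.
pose fM i : {scalar 'cV[R]_d} := f i \o mulmx M.
have fMN0 i : exists u, fM i u != 0.
  have [u fu] := reflecting_form_neq0 i; exists (M^T *m u).
  by rewrite /= mulmxA MM' mul1mx.
have /choice [s sP] i : exists j, ker_form (f j) = ker_form (fM i).
  have [_ _ fsurj] := f_forms.
  have [|j _ <-] := fsurj (ker_form (fM i)); last by exists j.
  split; first exact/linear_hyperplane_form.
  have [_ [N [HN NP]]] := reflecting_form i; exists (M^T *m (N *m M)).
  split; last exact: reflection_conj NP.
  by case: HO => _ _ HM2 _; apply: HM2 (HM2 _ _ HN HM); exact: group_trmx.
have sfM i x : f (s i) x = 0 -> fM i x = 0.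
  by move=> fx; have : ker_form (f (s i)) x by []; rewrite sP.
have /choice [c cP] i : exists c, forall x, fM i x = c * f (s i) x.
  have [u fu] := reflecting_form_neq0 (s i).
  exists (fM i u / f (s i) u); exact: form_proportional fu (sfM i).
exists s, c; split=> // i j sij; apply: reflecting_forms_inj => x fx.
(* As [M] is invertible, equal pullbacks come from equal hyperplanes. *)
have : ker_form (fM i) (M^T *m x) by rewrite /ker_form /= mulmxA MM' mul1mx.
by rewrite -sP sij sP /ker_form /= mulmxA MM' mul1mx.
Qed.

Lemma prod_forms_semi_invariant M : H M ->
  exists c, forall x, prod_forms f (M *m x) = c * prod_forms f x.
Proof.
move=> /group_permutes_forms [s [c [s_inj fM]]]; exists (\prod_i c i) => x.
rewrite /prod_forms [X in _ = _ * X](reindex_inj s_inj) -big_split /=.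
by apply: eq_bigr => i _; rewrite fM.
Qed.

(* The simple zero of the product along the normal at a generic point of the
   hyperplane makes the semi-invariance factor equal to [-1]. *)
Lemma prod_forms_reflection i M x : H M ->
  is_reflection_through (ker_form (f i)) M ->
  prod_forms f (M *m x) = - prod_forms f x.
Proof.
move=> HM MP; have [c cP] := prod_forms_semi_invariant HM.
suff cN1 : c = -1 by rewrite cP cN1 mulN1r.
have nN0 := form_normal_neq0 (reflecting_form_neq0 i).
have MN := reflection_normal MP; set n := normal (f i) in nN0 MN.
(* Orthogonal projection onto the kernel of [f i]; the generic [w] projects off all other
   hyperplanes. *)
pose proj x := x - (f i x / f i n) *: n.
have projE j y : f j (proj y) = f j y - f i y / f i n * f j n.
  by rewrite linearB linearZ.
have fproj y : f i (proj y) = 0 by rewrite projE divfK // subrr.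
have [w w_gen] : exists w, forall j, j != i -> f j (proj w) != 0.
  apply: (@common_nonzero _ _ _ [pred j | j != i] (fun j => f j \o proj)) => j ji.
    by move=> t u v; rewrite /= !projE !linearP /=; ring.
  apply: contrapT => noN0; case/eqP: ji; apply/esym.
  apply: reflecting_forms_inj => y fy.
  apply/eqP/negPn/negP => fjy; apply: noN0; exists y.
  by rewrite /= /proj fy mul0r scale0r subr0.
pose y := proj w; have My : M *m y = y by case: MP => + _; apply; exact: fproj.
pose Q := \prod_(j | j != i) ((f j y)%:P + f j n *: 'X).
have PQ t : prod_forms f (y + t *: n) = t * f i n * Q.[t].
  rewrite /prod_forms (bigD1 i) //= linearD linearZ fproj add0r /=; congr (_ * _).
  rewrite horner_prod; apply: eq_bigr => j _.
  by rewrite !hornerE linearD linearZ /= [t * _]mulrC.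
have Q0 : Q.[0] != 0.
  by rewrite horner_prod; apply/prodf_neq0 => j ji; rewrite !hornerE w_gen.
(* [M] sends [y + t *: n] to [y - t *: n], so semi-invariance gives this identity after cancelling
   [t * f i n]. Evaluating it at 0, where [Q] is nonzero, yields [c = -1]. *)
have : c *: Q + (Q \Po (- 'X)) = 0.
  apply: (@horner_eq0_off_roots _ _ 'X); rewrite ?polyX_eq0 // => t.
  rewrite hornerX => tN0; rewrite hornerD hornerZ horner_comp hornerN hornerX.
  have := cP (y + t *: n); rewrite mulmxDr -scalemxAr My MN scalerN -scaleNr !PQ.
  move=> E; apply: (mulfI (mulf_neq0 tN0 nN0)); rewrite mulr0.
  by rewrite mulrDr mulrCA -E !mulNr addNr.
move/(congr1 (horner^~ 0)); rewrite hornerD hornerZ horner_comp hornerN hornerX.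
rewrite oppr0 horner0 -[X in _ + X]mul1r -mulrDl => /eqP.
by rewrite mulf_eq0 (negbTE Q0) orbF addr_eq0 => /eqP.
Qed.

(* On a generic line [g] has [r] distinct zeros, one on each hyperplane; every
   line in a generic direction contains points through which this applies. *)
Lemma polynomial_vanishing_on_hyperplanes (g : 'cV[R]_d -> R) :
  (forall x v, exists2 p : {poly R},
     (size p <= r)%N & forall t, g (x + t *: v) = p.[t]) ->
  (forall i x, f i x = 0 -> g x = 0) -> forall x, g x = 0.
Proof.
move=> g_poly g_van.
have [v fv] : exists v, forall i, i \in 'I_r -> f i v != 0.
  apply: common_nonzero => i _; last exact: reflecting_form_neq0.
  by move=> t u w; rewrite linearP.
(* Zero exactly when the line through [x] along [v] meets both hyperplanes at the same parameter. *)
pose h (ij : 'I_r * 'I_r) x := f ij.1 v * f ij.2 x - f ij.2 v * f ij.1 x.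
have h_lin ij : scalar (h ij) by move=> t u w; rewrite /h !linearP /=; ring.
have g_generic x : (forall ij, ij.1 != ij.2 -> h ij x != 0) -> g x = 0.
  move=> hx; have [p p_size pE] := g_poly x v.
  suff p0 : p = 0 by rewrite -[x]addr0 -(scale0r v) pE p0 horner0.
  apply/eqP; apply: contraTT p_size => pN0; rewrite -ltnNge.
  have := @max_poly_roots _ p [seq - f i x / f i v | i <- enum 'I_r] pN0.
  rewrite size_map size_enum_ord; apply.
    apply/allP => _ /mapP[i _ ->]; rewrite /root -pE (g_van i) //.
    by rewrite linearD linearZ /= divfK ?fv // addrN.
  rewrite map_inj_uniq ?enum_uniq // => i j E.
  apply/eqP; apply: contraT => /(hx (i, j)) /eqP; case; rewrite /h /=.
  have [fvi fvj] := (fv i isT, fv j isT).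
  have -> : f i x = - (- f i x / f i v) * f i v by rewrite mulNr divfK // opprK.
  by rewrite E; field.
have [w hw] : exists w, forall ij, ij.1 != ij.2 -> h ij w != 0.
  apply: (@common_nonzero _ _ _ [pred ij | ij.1 != ij.2]) => // -[i j] /= ij.
  apply: contrapT => hN0; case/eqP: ij; apply: reflecting_forms_inj => x fx.
  apply/eqP/negPn/negP => fjx; apply: hN0; exists x.
  by rewrite /h /= fx mulr0 subr0 mulf_neq0 ?fv.
move=> x; have [p _ pE] := g_poly x w.
suff p0 : p = 0 by rewrite -[x]addr0 -(scale0r w) pE p0 horner0.
(* Its roots are the finitely many [t] for which [x + t *: w] is not generic. *)
pose q := \prod_(ij | ij.1 != ij.2) ((h ij x)%:P + h ij w *: 'X).
have hE ij t : h ij (x + t *: w) = ((h ij x)%:P + h ij w *: 'X).[t].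
  rewrite [x + _]addrC h_lin hornerD hornerC hornerZ hornerX [t * _]mulrC.
  exact: addrC.
apply: (@horner_eq0_off_roots _ _ q) => [|t].
  apply/prodf_neq0 => ij ijN; apply/eqP => /polyP /(_ 1).
  rewrite coefD coefC coefZ coefX /= mulr1 add0r coef0 => /eqP.
  exact/negP/hw.
rewrite horner_prod => /prodf_neq0 qt; rewrite -pE.
by apply: g_generic => ij ijN; rewrite hE qt.
Qed.

(** * Degree and zeros of the discrete Laplacian of the product *)

Section Laplacian.
Context {S : {fset 'cV[R]_d}} {a : 'cV[R]_d -> R}.

(** Translating by [s] changes only the constant terms of the factors, so the coefficients of index
    at least [r] agree for all [s] and cancel against those of [q x]. *)
Lemma laplacian_prod_forms_on_line x v : \sum_(s <- S) a s = 1 ->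
  exists2 p : {poly R}, (size p <= r)%N &
    forall t, laplacian S a (prod_forms f) (x + t *: v) = p.[t].
Proof.
move=> a_sum; pose q y := \prod_(i < r) ((f i y)%:P + f i v *: 'X).
have qE y t : prod_forms f (y + t *: v) = (q y).[t].
  rewrite horner_prod; apply: eq_bigr => i _.
  by rewrite !hornerE linearD linearZ /= mulrC.
exists (\sum_(s <- S) a s *: q (x + s) - q x) => [|t].
  apply/leq_sizeP => j le_rj; rewrite coefB coef_sum coef_prod_affine //.
  under eq_bigr do rewrite coefZ coef_prod_affine //.
  by rewrite -mulr_suml a_sum mul1r subrr.
rewrite /laplacian hornerD hornerN qE horner_sum; congr (_ - _).
by apply: eq_bigr => s _; rewrite hornerZ -qE addrAC.
Qed.

(** Reindexing the sum by the reflection [M], which fixes [x], shows that the value equals its own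
    opposite. *)
Lemma laplacian_prod_forms_on_hyperplane i x :
  (forall M, H M -> [fset M *m s | s in S]%fset = S) ->
  (forall M s, H M -> s \in S -> a (M *m s) = a s) ->
  f i x = 0 -> laplacian S a (prod_forms f) x = 0.
Proof.
move=> S_inv a_inv fx; have [_ [M [HM MP]]] := reflecting_form i.
have Mx : M *m x = x by case: MP => + _; apply.
have M_inj : injective (mulmx M : 'cV[R]_d -> _).
  apply: (can_inj (g := mulmx M^T)) => y.
  by rewrite mulmxA orthogonal_trmxK // mul1mx.
suff : laplacian S a (prod_forms f) x = - laplacian S a (prod_forms f) x.
  by move/eqP; rewrite -addr_eq0 -mulr2n mulrn_eq0 => /eqP.
rewrite {1}/laplacian -{1}(S_inv _ HM) big_imfset /=; last first.
  by move=> y z _ _ /M_inj.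
rewrite -{2}Mx (prod_forms_reflection _ HM MP) opprB opprK addrC; congr (_ + _).
rewrite -sumrN !big_seq; apply: eq_bigr => s sS.
by rewrite a_inv // -{1}Mx -mulmxDr (prod_forms_reflection _ HM MP) mulrN.
Qed.

End Laplacian.

End Arrangement.

Theorem theorem4 (R : realType) (d : nat) (Z : 'M[R]_d) (C : set 'cV[R]_d)
    (H : set 'M[R]_d) (S : {fset 'cV[R]_d}) (a : 'cV[R]_d -> R)
    (r : nat) (f : 'I_r -> {scalar 'cV[R]_d})
    (d_ge2 : (2 <= d)%N)
    (Z_aut : Z \in unitmx)
    (C_cone : C = [set Z *m x | x in orthant])
    (H_coxeter : finite_coxeter_group H)
    (C_chamber : weyl_chamber H C)
    (a_ge0 : forall s, s \in S -> 0 <= a s)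
    (a_sum : \sum_(s <- S) a s = 1)
    (a_drift : \sum_(s <- S) a s *: s = 0)
    (a_cov : forall i j : 'I_d,
      \sum_(s <- S) a s * s i 0 * s j 0 = (i == j)%:R)
    (S_inv : forall h, H h -> [fset h *m s | s in S]%fset = S)
    (a_inv : forall h s, H h -> s \in S -> a (h *m s) = a s)
    (f_forms : reflecting_forms H f)
    (P0_gt0 : forall x, interior C x -> 0 < prod_forms f x) :
  laplacian S a (prod_forms f) = cst 0.
Proof.
have [HO _ _] := H_coxeter; apply/funext => x.
apply: (polynomial_vanishing_on_hyperplanes f_forms) => [y v|i y].
  exact: laplacian_prod_forms_on_line.
exact: (laplacian_prod_forms_on_hyperplane HO f_forms).
Qed.
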